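(* Let $f$ be a power series with $f(0)=0$ and $f'(0)\equiv1\pmod 2$. The Riordan graph $G=G_n(f',f)$ is ie-decomposable if and only if $(t+t^2)f'\equiv f$, i.e. $[t^{2m-1}]f\equiv[t^{2m}]f$ for all $m\ge1$.
   Context: Power series are in the variable $t$ with coefficients in $\mathbb{Z}$ (or $\mathbb{Z}_2$); $\equiv$ means congruence mod $2$ (coefficientwise for power series); $'$ is the formal derivative; $[t^k]u$ is the coefficient of $t^k$ in $u$. For power series $g,f$ with $f(0)=0$, the Riordan graph $G_n(g,f)$ is the simple graph on the vertex set $\{1,\dots,n\}$ in which, for $i>j\ge1$, the vertices $i$ and $j$ are adjacent if and only if $[t^{i-2}]\,g f^{\,j-1}\equiv 1$. It is proper if the matrix of the coefficients $[t^i]gf^j$ mod $2$, $0\le i,j\le n-2$, is a proper (i.e. invertible) binary Riordan matrix, which means $g(0)\equiv f'(0)\equiv1$. A proper Riordan graph $G_n(g,f)$, with odd vertex set $V_o$ and even vertex set $V_e$, is ie-decomposable if the induced subgraph $\langle V_o\rangle$ is a null graph (no edges) and the induced subgraph $\langle V_e\rangle$ is isomorphic (as a graph) to $G_{\lfloor n/2\rfloor}(g,f)$.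
   Formalization: The condition ''G_n(f',f) is ie-decomposable'' is taken to hold for every n ≥ 1; for a single fixed n the ''only if'' direction fails (n = 1, f = t). *)

(* Defs.v *)
From HB Require Import structures.
From mathcomp Require Import all_boot all_order all_algebra.

Set Implicit Arguments.
Unset Strict Implicit.
Unset Printing Implicit Defensive.

Import GRing.Theory.
Local Open Scope ring_scope.

(* Formal power series in t over the integers; [u k] is the coefficient of t^k. *)
Definition series := nat -> int.

Definition sone : series := fun k => (k == 0%N)%:R.
Definition sX : series := fun k => (k == 1%N)%:R.
Definition sadd (u v : series) : series := fun k => u k + v k.
Definition smul (u v : series) : series :=
  fun k => \sum_(i < k.+1) u i * v (k - i)%N.
Definition sexp (u : series) (m : nat) : series := iter m (smul u) sone.
Definition sderiv (u : series) : series := fun k => u k.+1 *+ k.+1.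

Definition seqmod2 (u v : series) : Prop :=
  forall k, (u k = v k %[mod 2])%Z.

Record sgraph := SGraph {
  vert :> finType;
  adj : rel vert;
  adj_sym : symmetric adj;
  adj_irr : irreflexive adj }.

Section Induced.
Variables (G : sgraph) (A : {set G}).

Definition induced_adj : rel {x : G | x \in A} :=
  fun x y => adj (val x) (val y).

Lemma induced_adj_sym : symmetric induced_adj.
Proof. by move=> x y; rewrite /induced_adj adj_sym. Qed.

Lemma induced_adj_irr : irreflexive induced_adj.
Proof. by move=> x; rewrite /induced_adj adj_irr. Qed.

Definition induced : sgraph := SGraph induced_adj_sym induced_adj_irr.
End Induced.

Definition null_graph (G : sgraph) : Prop := forall x y : G, ~~ adj x y.

Definition graph_iso (G H : sgraph) : Prop :=
  exists2 h : G -> H, bijective h & forall x y, adj (h x) (h y) = adj x y.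

(* The vertex set {1, ..., n} is encoded as 'I_n, with x standing for the     *)
(* vertex labelled x + 1; in particular odd labels are even elements of 'I_n. *)
Definition label n (x : 'I_n) : nat := x.+1.

Section Riordan.
Variables (n : nat) (g f : series).

(* Only used with j >= 1, so that i > j gives i >= 2 and the natural number    *)
(* subtractions i - 2 and j - 1 are exact.                                     *)
Definition riordan_edge (i j : nat) : bool :=
  (j < i)%N && (smul g (sexp f (j - 1)) (i - 2)%N == 1 %[mod 2])%Z.

Definition riordan_adj : rel 'I_n := fun x y =>
  riordan_edge (label x) (label y) || riordan_edge (label y) (label x).

Lemma riordan_adj_sym : symmetric riordan_adj.
Proof. by move=> x y; rewrite /riordan_adj orbC. Qed.

Lemma riordan_adj_irr : irreflexive riordan_adj.
Proof. by move=> x; rewrite /riordan_adj /riordan_edge ltnn. Qed.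

Definition riordan_graph : sgraph := SGraph riordan_adj_sym riordan_adj_irr.

Definition odd_vertices : {set riordan_graph} :=
  [set x : 'I_n | odd (label x)].
Definition even_vertices : {set riordan_graph} :=
  [set x : 'I_n | ~~ odd (label x)].
End Riordan.

Definition riordan_proper (g f : series) : Prop :=
  (g 0%N = 1 %[mod 2])%Z /\ (sderiv f 0%N = 1 %[mod 2])%Z.

Definition ie_decomposable (n : nat) (g f : series) : Prop :=
  [/\ riordan_proper g f,
      null_graph (induced (odd_vertices n g f)) &
      graph_iso (induced (even_vertices n g f)) (riordan_graph n./2 g f)].

(* Main.v *)
Require Import Defs.
From HB Require Import structures.
From mathcomp Require Import all_boot all_order all_algebra.
From mathcomp Require Import ring zify.

Set Implicit Arguments.
Unset Strict Implicit.
Unset Printing Implicit Defensive.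

Import GRing.Theory.
Local Open Scope ring_scope.

(** Work modulo 2 and put d = f - (t + t^2) f', so that the congruence in the
theorem says d = 0.  Since f' has only even exponents, the odd coefficients of
d vanish (as f(0) = 0) and its coefficient at 2m > 0 is [t^(2m)]f -
[t^(2m-1)]f; this is [defectE], and it gives the second equivalence.

Squares are also series in t^2, so f' f^(2b) has no odd coefficient: the odd
vertices never span an edge ([edge_odd]).  For the even vertices, writing one
factor f as d + (t + t^2) f' gives
  f' f^(2b+1) = d f' f^(2b) + (t + t^2) (f' f^b)^2.
In even degree 2a+2 the second term contributes the coefficient of t^a in
f' f^b, which is exactly the entry deciding adjacency in the smaller graph.

If d = 0, halving the labels is therefore an isomorphism from the graph on the
even vertices to the smaller graph, and G is ie-decomposable.

Conversely, an isomorphism for every n is arbitrary, so only invariants can be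
used; the number of edges suffices.  Going from m to m + 1 vertices on
both sides, it shows that the new vertex has as many earlier neighbours in one
graph as in the other ([row_count]).  If d were nonzero, let 2m be its lowest
exponent.  As f(0) = 0, the series d f' f^(2b) has order at least 2m + 2b, so
in the row of the new vertex m + 1 the two graphs differ in the entry b = 0 and
in no other ([edge_even]): their counts differ by one, a contradiction. *)

(** * Polynomials over the field with two elements *)

Lemma pchar_F2 : 2%N \in [pchar 'F_2].
Proof. exact: pchar_Fp. Qed.

Lemma pchar_polyF2 : 2%N \in [pchar {poly 'F_2}].
Proof. by rewrite pchar_poly pchar_F2. Qed.

Lemma F2_cases (u : 'F_2) : u = 0 \/ u = 1.
Proof. by case: u => [[|[|k]] Hk] //; [left | right]; apply: val_inj. Qed.

Lemma F2_eq1 (u v : 'F_2) : ((u == 1) == (v == 1)) = (u == v).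
Proof. by case: (F2_cases u) => ->; case: (F2_cases v) => ->. Qed.

Lemma mulrn_F2 (u : 'F_2) n : u *+ n = if odd n then u else 0.
Proof.
rewrite -{1}(odd_double_half n) mulrnDr -mul2n mulrnA.
by rewrite (mulrn_pchar pchar_F2) mul0rn addr0; case: odd.
Qed.

Lemma sqr_polyF2 (q : {poly 'F_2}) : q ^+ 2 = q \Po 'X^2.
Proof.
elim/poly_ind: q => [|q c IHq]; first by rewrite comp_poly0 expr0n.
rewrite comp_polyD comp_polyM comp_polyX comp_polyC -IHq.
rewrite sqrrD exprMn (mulrn_pchar pchar_polyF2) addr0; congr (_ + _).
by rewrite -polyC_exp; case: (F2_cases c) => ->; rewrite ?expr0n ?expr1n.
Qed.

Lemma coef_sqr_polyF2 (q : {poly 'F_2}) k :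
  (q ^+ 2)`_k = if odd k then 0 else q`_k./2.
Proof. by rewrite sqr_polyF2 coef_comp_poly_Xn // dvdn2 divn2; case: odd. Qed.

Lemma coef_deriv_F2 (p : {poly 'F_2}) k :
  p^`()`_k = if odd k then 0 else p`_k.+1.
Proof. by rewrite coef_deriv mulrn_F2 /=; case: odd. Qed.

(** Both factors are polynomials in X^2. *)
Lemma coef_deriv_sqr_odd (p q : {poly 'F_2}) k :
  odd k -> (p^`() * q ^+ 2)`_k = 0.
Proof.
move=> k_odd; rewrite coefM big1 // => i _.
rewrite coef_deriv_F2 coef_sqr_polyF2.
case: ifPn => [_|i_even]; first by rewrite mul0r.
by rewrite oddB ?k_odd ?(negbTE i_even) ?mulr0 // -ltnS.
Qed.

Definition pdefect (p : {poly 'F_2}) : {poly 'F_2} :=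
  p - ('X + 'X^2) * p^`().

(** One factor p of the odd power is replaced by pdefect p + (X + X^2) p'; the
remaining factors then complete the square of p' p^b, from which X^2 picks the
even degrees and X the odd ones. *)
Lemma coef_deriv_odd_power (p : {poly 'F_2}) a b :
  (p^`() * p ^+ b.*2.+1)`_(a.+1.*2) =
  (pdefect p * (p^`() * p ^+ b.*2))`_(a.+1.*2) + (p^`() * p ^+ b)`_a.
Proof.
have -> : p^`() * p ^+ b.*2.+1 = pdefect p * (p^`() * p ^+ b.*2)
    + ((p^`() * p ^+ b) ^+ 2 * 'X + (p^`() * p ^+ b) ^+ 2 * 'X^2).
  rewrite /pdefect exprS -muln2 exprM; ring.
rewrite !coefD; congr (_ + _).
rewrite coefMX coefMXn !coef_sqr_polyF2 /= odd_double add0r.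
by rewrite subn2 /= odd_double doubleK.
Qed.

Lemma coef_mul_lowest (R : comNzRingType) (d q : {poly R}) n :
  (forall i, (i < n)%N -> d`_i = 0) -> (d * q)`_n = d`_n * q`_0.
Proof.
move=> d_low; rewrite coefM big_ord_recr /= subnn big1 ?add0r // => i _.
by rewrite d_low ?mul0r.
Qed.

(** * Reduction of integer series modulo 2 *)

Definition red (z : int) : 'F_2 := z%:~R.

Lemma eqmod2_red (a b : int) : (a == b %[mod 2])%Z = (red a == red b).
Proof.
by rewrite eqz_mod_dvd (dvdz_pcharf pchar_F2) rmorphB subr_eq0.
Qed.

Lemma eqmod2P (a b : int) : (a = b %[mod 2])%Z <-> red a = red b.
Proof.
by split=> [/eqP|/eqP H]; last apply/eqP; rewrite eqmod2_red => // /eqP.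
Qed.

(** Series are compared with polynomials up to a fixed degree, which is enough
because each edge depends on finitely many coefficients, and which makes the
ring structure of polynomials available. *)
Definition agree (N : nat) (u : series) (p : {poly 'F_2}) : Prop :=
  forall i, (i <= N)%N -> red (u i) = p`_i.

Lemma agree_mul N u v p q :
  agree N u p -> agree N v q -> agree N (smul u v) (p * q).
Proof.
move=> up vq i iN; rewrite coefM /red /smul rmorph_sum.
apply: eq_bigr => j _; rewrite rmorphM /= -!/(red _) up ?vq //.
  exact: leq_trans (leq_subr _ _) iN.
by apply: leq_trans iN; rewrite -ltnS.
Qed.

Lemma agree_exp N u p m : agree N u p -> agree N (sexp u m) (p ^+ m).
Proof.
move=> up; elim: m => [|m IHm] /=.
  by move=> i _; rewrite expr0 coef1 /red /sone; case: (i == 0%N).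
by rewrite exprS; apply: agree_mul.
Qed.

Lemma agree_tt2 N : agree N (sadd sX (sexp sX 2)) ('X + 'X^2).
Proof.
have aX : agree N sX 'X by move=> i _; rewrite coefX /red /sX; case: (i == 1%N).
move=> i iN; rewrite coefD -aX // -(agree_exp 2 aX) //.
by rewrite /red /sadd rmorphD.
Qed.

(** The coefficient of degree N + 1 is kept so that the derivative is still
correct in degree N. *)
Definition trunc (N : nat) (f : series) : {poly 'F_2} :=
  \poly_(i < N.+2) red (f i).

Lemma agree_trunc N f : agree N f (trunc N f).
Proof. by move=> i iN; rewrite coef_poly ltnS leqW. Qed.

Lemma agree_deriv_trunc N f : agree N (sderiv f) (trunc N f)^`().
Proof.
by move=> i iN; rewrite coef_deriv coef_poly !ltnS iN /red /sderiv rmorphMn.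
Qed.

Lemma agree_entry N f j :
  agree N (smul (sderiv f) (sexp f j)) ((trunc N f)^`() * trunc N f ^+ j).
Proof.
apply: agree_mul; first exact: agree_deriv_trunc.
by apply: agree_exp; apply: agree_trunc.
Qed.

Definition defect (f : series) (k : nat) : 'F_2 :=
  red (f k) - red (smul (sadd sX (sexp sX 2)) (sderiv f) k).

Lemma defect_trunc N f k : (k <= N)%N -> defect f k = (pdefect (trunc N f))`_k.
Proof.
move=> kN; rewrite coefB -(agree_mul (@agree_tt2 N) (@agree_deriv_trunc N f)) //.
by rewrite -agree_trunc.
Qed.

Lemma defect_eq0 f :
  seqmod2 (smul (sadd sX (sexp sX 2)) (sderiv f)) f <->
  forall k, defect f k = 0.
Proof.
split=> [H k | H k].
  by apply/eqP; rewrite subr_eq0 eq_sym; apply/eqP/eqmod2P.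
apply/eqmod2P/eqP; rewrite eq_sym -subr_eq0; apply/eqP.
exact: H.
Qed.

Lemma defectE f k : f 0%N = 0 ->
  defect f k = if odd k then 0 else red (f k) - red (f k.-1).
Proof.
move=> f0; rewrite (@defect_trunc k) // coefB mulrDl coefD.
rewrite mulrC coefMX mulrC coefMXn !coef_deriv_F2.
have tE i : (i <= k)%N -> (trunc k f)`_i = red (f i) by move/agree_trunc->.
case: k tE => [|[|k]] tE /=; rewrite ?subn2 /= ?tE ?f0 ?addr0 ?subrr //.
by case: (odd k) => /=; rewrite ?addr0 ?add0r ?subrr.
Qed.

Lemma entry_odd f k b : odd k ->
  red (smul (sderiv f) (sexp f b.*2) k) = 0.
Proof.
move=> k_odd; rewrite (agree_entry f b.*2 (leqnn k)) -muln2 exprM.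
exact: coef_deriv_sqr_odd.
Qed.

(** The defect enters with its lowest coefficient only: below degree 2a + 2 it
vanishes, so its product with f' f^(2b) has in that degree the coefficient of
the defect times the constant term of f' f^(2b), which is 1 for b = 0 and 0
otherwise. *)
Lemma entry_even f a b : f 0%N = 0 -> (sderiv f 0%N = 1 %[mod 2])%Z ->
    (forall k, (k < a.+1.*2)%N -> defect f k = 0) ->
  red (smul (sderiv f) (sexp f b.*2.+1) a.+1.*2) =
  defect f a.+1.*2 * (b == 0%N)%:R + red (smul (sderiv f) (sexp f b) a).
Proof.
move=> f0 /eqmod2P f'0 low; set N := a.+1.*2.
have aN : (a <= N)%N by rewrite /N; lia.
rewrite (agree_entry f _ (leqnn N)) (agree_entry f _ aN) coef_deriv_odd_power.
rewrite coef_mul_lowest => [|i iN]; last by rewrite -defect_trunc ?low // ltnW.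
rewrite -defect_trunc // -/N -!horner_coef0 hornerM horner_exp !horner_coef0.
rewrite -agree_deriv_trunc // -agree_trunc // f'0 f0 mul1r expr0n double_eq0.
by [].
Qed.

(** * Edges *)

Lemma edge_odd f i j : odd i -> odd j ->
  riordan_edge (sderiv f) f i j = false.
Proof.
move=> i_odd j_odd; apply/negbTE/negP=> /andP[ji].
have -> : (j - 1 = j./2.*2)%N by lia.
rewrite eqmod2_red entry_odd //; lia.
Qed.

(** An equivalence of booleans serves both directions: with zero defect it
identifies the two graphs, and for b = 0 it reads off a coefficient of the
defect from a comparison of edges. *)
Lemma edge_even f a b : f 0%N = 0 -> (sderiv f 0%N = 1 %[mod 2])%Z ->
    (forall k, (k < a.*2)%N -> defect f k = 0) -> (b < a)%N ->
  (riordan_edge (sderiv f) f a.+1.*2 b.+1.*2 ==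
     riordan_edge (sderiv f) f a.+1 b.+1) =
  (b != 0%N) || (defect f a.*2 == 0).
Proof.
case: a => // a f0 f'0 low ba.
have -> : riordan_edge (sderiv f) f a.+2.*2 b.+1.*2 =
  (red (smul (sderiv f) (sexp f b.*2.+1) a.+1.*2) == 1).
  rewrite /riordan_edge ltn_double ltnS ba eqmod2_red.
  by rewrite !doubleS !subSS !subn0.
have -> : riordan_edge (sderiv f) f a.+2 b.+1 =
  (red (smul (sderiv f) (sexp f b) a) == 1).
  by rewrite /riordan_edge !ltnS -ltnS ba eqmod2_red !subSS !subn0.
rewrite F2_eq1 entry_even // -subr_eq0 addrK mulf_eq0 orbC.
by case: (b == 0%N); rewrite ?orbF ?orbT.
Qed.

Definition sym_rel (E : rel nat) : rel nat := fun x y => E x y || E y x.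

Lemma edge_lt g f i j : riordan_edge g f i j -> (j < i)%N.
Proof. by case/andP. Qed.

Definition even_edge f : rel nat :=
  fun x y => riordan_edge (sderiv f) f x.+1.*2 y.+1.*2.
Definition all_edge f : rel nat :=
  fun x y => riordan_edge (sderiv f) f x.+1 y.+1.

(** This relabelling is the isomorphism when the defect vanishes; in general it
only serves to index the even vertices by an initial segment. *)
Lemma even_vertices_half n g f :
  exists2 h : {x : riordan_graph n g f | x \in even_vertices n g f} -> 'I_(n./2),
    bijective h & forall x, label (val x : 'I_n) = (h x).+1.*2.
Proof.
have hP (x : {x : riordan_graph n g f | x \in even_vertices n g f}) :
    ((val x : 'I_n)./2 < n./2)%N.
  case: x => x /=; rewrite inE /label /= => x_odd.
  by have := ltn_ord (x : 'I_n); lia.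
have kP (y : 'I_(n./2)) : (y.*2.+1 < n)%N by have := ltn_ord y; lia.
have kQ (y : 'I_(n./2)) :
    (Ordinal (kP y) : riordan_graph n g f) \in even_vertices n g f.
  by rewrite inE /label /= odd_double.
exists (fun x => Ordinal (hP x)).
  exists (fun y => exist (fun x => x \in even_vertices n g f) _ (kQ y))
    => [[x xP]|y]; apply: val_inj => /=.
    by apply: val_inj => /=; move: xP; rewrite inE /label /=; lia.
  by rewrite uphalf_double.
case=> x xP; have : ~~ odd (label x) by move: xP; rewrite inE.
by rewrite /label /=; lia.
Qed.

(** * Counting edges *)

(** Each edge is counted twice, once per orientation. *)
Definition arcs (G : sgraph) : nat := \sum_(x : G) \sum_(y : G) adj x y.

Lemma arcs_bij (G : sgraph) (T : finType) (h : G -> T) (e : rel T) :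
    bijective h -> (forall x y, e (h x) (h y) = adj x y) ->
  arcs G = (\sum_(x : T) \sum_(y : T) e x y)%N.
Proof.
move=> h_bij he; rewrite (reindex h) /=; last exact: onW_bij.
apply: eq_bigr => x _; rewrite (reindex h) /=; last exact: onW_bij.
by apply: eq_bigr => y _; rewrite he.
Qed.

Lemma arcs_iso G H : graph_iso G H -> arcs G = arcs H.
Proof. by case=> h h_bij hE; apply: arcs_bij h_bij hE. Qed.

Definition nb_arcs (E : rel nat) m : nat :=
  \sum_(x < m) \sum_(y < m) sym_rel E x y.

Lemma nb_arcsS (E : rel nat) m : (forall x y, E x y -> (y < x)%N) ->
  nb_arcs E m.+1 = (nb_arcs E m + (\sum_(y < m) E m y).*2)%N.
Proof.
move=> E_lt; rewrite /nb_arcs big_ord_recr /=.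
under eq_bigr do rewrite big_ord_recr /=.
rewrite big_split /= big_ord_recr /= -addnA; congr (_ + _)%N.
have EF x y : (x <= y)%N -> E x y = false.
  by move=> xy; apply: contraTF xy => /E_lt; rewrite -ltnNge.
rewrite {3}/sym_rel EF // addn0 -addnn; congr (_ + _)%N; apply: eq_bigr => y _;
  by rewrite /sym_rel [E y m]EF ?orbF // ltnW.
Qed.

(** Equal numbers of edges on all initial segments give, by subtraction, equal
numbers of edges from each vertex to earlier ones. *)
Lemma row_count (E1 E2 : rel nat) :
    (forall x y, E1 x y -> (y < x)%N) -> (forall x y, E2 x y -> (y < x)%N) ->
    (forall m, nb_arcs E1 m = nb_arcs E2 m) ->
  forall m, (\sum_(y < m) E1 m y = \sum_(y < m) E2 m y)%N.
Proof.
move=> lt1 lt2 eqE m; apply: double_inj.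
by have := eqE m.+1; rewrite !nb_arcsS // eqE => /addnI.
Qed.

Lemma ie_nb_arcs f m : ie_decomposable m.*2 (sderiv f) f ->
  nb_arcs (even_edge f) m = nb_arcs (all_edge f) m.
Proof.
case=> _ _ /arcs_iso; rewrite doubleK => eq_arcs.
transitivity (arcs (induced (even_vertices m.*2 (sderiv f) f))).
  have [h h_bij hE] := even_vertices_half m.*2 (sderiv f) f.
  rewrite (arcs_bij (G := induced (even_vertices m.*2 (sderiv f) f))
    (e := fun x y : 'I_(m.*2./2) => sym_rel (even_edge f) x y) h_bij).
    by rewrite doubleK.
  by move=> x y; rewrite /= /induced_adj /= /riordan_adj !hE.
by rewrite eq_arcs.
Qed.

(** Strong induction on the degree: once the defect vanishes below 2m, the rows
of index m of the two graphs agree except perhaps in column 0, and the equality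
of their sums then forces the defect to vanish in degree 2m. *)
Lemma ie_decomposable_defect f : f 0%N = 0 -> (sderiv f 0%N = 1 %[mod 2])%Z ->
    (forall n, (0 < n)%N -> ie_decomposable n (sderiv f) f) ->
  forall k, defect f k = 0.
Proof.
move=> f0 f'0 ie.
have rowE : forall m,
    (\sum_(y < m) even_edge f m y = \sum_(y < m) all_edge f m y)%N.
  apply: row_count => [x y /edge_lt|x y /edge_lt|[|m]].
  - by rewrite ltn_double.
  - by [].
  - by rewrite /nb_arcs !big_ord0.
  by apply: ie_nb_arcs; apply: ie; rewrite double_gt0.
elim/ltn_ind=> k low.
have [k_odd|k_even] := boolP (odd k); first by rewrite defectE // k_odd.
have kE : k = k./2.*2 by lia.
rewrite kE in low *; move: k./2 low => [|m] low {k k_even kE}.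
  by rewrite defectE // f0 subrr.
have := rowE m.+1; rewrite !big_ord_recl.
have edgeE := edge_even f0 f'0 low.
(* The columns of positive index agree and cancel from the two row sums. *)
rewrite (eq_bigr (fun i : 'I_m => (all_edge f m.+1 (lift ord0 i) : nat))).
  move/addIn => H; apply/eqP; rewrite -[_ == 0]/((0 != 0)%N || _).
  rewrite -edgeE //; apply/eqP; move: H; rewrite /even_edge /all_edge /=.
  by do 2![case: riordan_edge].
by move=> i _; congr nat_of_bool; apply/eqP; rewrite /even_edge edgeE.
Qed.

Lemma defect_ie_decomposable f n :
    f 0%N = 0 -> (sderiv f 0%N = 1 %[mod 2])%Z ->
    (forall k, defect f k = 0) ->
  ie_decomposable n (sderiv f) f.
Proof.
move=> f0 f'0 d0; split=> //.
  move=> [x xP] [y yP]; rewrite /= /induced_adj /= /riordan_adj.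
  by move: xP yP; rewrite !inE => xP yP; rewrite !edge_odd.
have [h h_bij hE] := even_vertices_half n (sderiv f) f.
exists h => // x y; rewrite /= /induced_adj /= /riordan_adj !hE.
have edgeE a b : riordan_edge (sderiv f) f a.+1 b.+1
               = riordan_edge (sderiv f) f a.+1.*2 b.+1.*2.
  have [ba|ab] := ltnP b a.
    by apply/esym/eqP; rewrite edge_even // d0 eqxx orbT.
  by rewrite /riordan_edge ltn_double !ltnS ltnNge ab.
by rewrite /label (edgeE (h x)) (edgeE (h y)).
Qed.

Theorem lemma4p25 (f : series)
    (f0 : f 0%N = 0) (f'0 : (sderiv f 0%N = 1 %[mod 2])%Z) :
  ((forall n : nat, (0 < n)%N -> ie_decomposable n (sderiv f) f) <->
   seqmod2 (smul (sadd sX (sexp sX 2)) (sderiv f)) f)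
  /\
  (seqmod2 (smul (sadd sX (sexp sX 2)) (sderiv f)) f <->
   (forall m : nat, (1 <= m)%N ->
      (f (2 * m - 1)%N = f (2 * m)%N %[mod 2])%Z)).
Proof.
split; split.
- by move=> ie; apply/defect_eq0; apply: ie_decomposable_defect.
- by move/defect_eq0=> d0 n _; apply: defect_ie_decomposable.
- move/defect_eq0=> d0 m _; apply/eqmod2P/eqP.
  rewrite eq_sym -subr_eq0 subn1; apply/eqP.
  by have := d0 (2 * m)%N; rewrite defectE // mul2n odd_double.
move=> fE; apply/defect_eq0=> k; rewrite defectE //.
case: ifPn => // k_even; case: (posnP k) => [-> | k_gt0].
  by rewrite subrr.
have kE : k = (2 * k./2)%N by lia.
have := fE k./2; rewrite -kE subn1 => /(_ _)/eqmod2P-> //; last by lia.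
by rewrite subrr.
Qed.
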